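(* Let $\nu\in(0,1]$ and $p=1+\nu$. Let $f:\mathbb{R}^n\to\mathbb{R}$ be Fréchet differentiable with $\nu$-Hölder continuous gradient on $\mathbb{R}^n$ with constant $L_\nu$, let $g:\mathbb{R}^n\to\mathbb{R}\cup\{+\infty\}$ be proper, lower semicontinuous, and high-order prox-bounded of order $p$ with threshold $\gamma^{g,p}>0$, and set $\varphi:=f+g$. Let $r>0$ be given and suppose $f\in\mathcal{C}^2(U)$ on an open set $U$ containing the closure of $\mathbf{B}(0;r)$. Then the following assertions hold: (a) There exists $\overline{\gamma}\in(0,\gamma^{g,p})$ such that for each $\gamma\in(0,\overline{\gamma})$, the condition $\varphi_\gamma^p\in\mathcal{C}^1(\mathbf{B}(0;r))$ implies that $\mathbf{T}_{\gamma\varphi}^{p}$ is single-valued and continuous on $\mathbf{B}(0;r)$. (b) If $\gamma\in(0,\gamma^{g,p})$ and $\mathbf{T}_{\gamma\varphi}^{p}$ is single-valued and continuous on $\mathbf{B}(0;r)$, then $\varphi_\gamma^p\in\mathcal{C}^1(\mathbf{B}(0;r))$ and, for $\overline{x}\in\mathbf{B}(0;r)$ and $\overline{y}=\mathbf{T}_{\gamma\varphi}^{p}(\overline{x})$, $$\nabla\varphi_\gamma^p(\overline{x})=\nabla^2f(\overline{x})(\overline{y}-\overline{x})+\frac{1}{\gamma}\|\overline{x}-\overline{y}\|^{p-2}(\overline{x}-\overline{y}).$$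
   Context: $\|\cdot\|$ and $\langle\cdot,\cdot\rangle$ are the Euclidean norm and inner product on $\mathbb{R}^n$; $\mathbf{B}(\overline{x};r)$ is the open ball with center $\overline{x}$ and radius $r$. The expression $\|z\|^{p-2}z$ is understood as $0$ when $z=0$. A function $h:\mathbb{R}^n\to\mathbb{R}\cup\{+\infty\}$ is proper if it is finite at some point. $\mathcal{C}^k(U)$ denotes the functions that are $k$-times continuously differentiable on $U$. $f$ has a $\nu$-Hölder continuous gradient with constant $L_\nu\ge 0$ if $\|\nabla f(y)-\nabla f(x)\|\le L_\nu\|y-x\|^\nu$ for all $x,y\in\mathbb{R}^n$. A proper function $g$ is high-order prox-bounded of order $p>1$ if there exist $\gamma>0$ and $x\in\mathbb{R}^n$ with $\inf_{y\in\mathbb{R}^n}\{g(y)+\frac{1}{p\gamma}\|x-y\|^p\}>-\infty$; the supremum of all such $\gamma$ is the threshold $\gamma^{g,p}\in(0,+\infty]$. For $\gamma>0$, the high-order forward-backward envelope and splitting mapping of $\varphi=f+g$ are, respectively, the infimum $\varphi_\gamma^p(x)$ and the set of minimizers $\mathbf{T}_{\gamma\varphi}^{p}(x)$ over $y\in\mathbb{R}^n$ of $$y\mapsto f(x)+\langle\nabla f(x),y-x\rangle+g(y)+\frac{1}{p\gamma}\|x-y\|^p.$$ When $\mathbf{T}_{\gamma\varphi}^{p}(x)$ is a singleton it is identified with its unique element. *)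

(* Defs.v *)
From mathcomp Require Export all_boot all_order all_algebra.
From mathcomp Require Export all_classical all_reals all_analysis.
Export Order.TTheory GRing.Theory Num.Theory.
Export numFieldNormedType.Exports.
#[export] Set Implicit Arguments.
#[export] Unset Strict Implicit.
#[export] Unset Printing Implicit Defensive.
Global Open Scope classical_set_scope.
Global Open Scope ring_scope.

(* R^n is 'rV[R]_n. The library norm `|x| on it is the max norm: it is used
   here only through the topology and Fréchet differentiability, which do not
   depend on the choice of a norm. All metric quantities use [enorm]. *)

Definition dotp (R : realType) (n : nat) (u v : 'rV[R]_n) : R :=
  \sum_(i < n) u 0 i * v 0 i.

Definition enorm (R : realType) (n : nat) (u : 'rV[R]_n) : R :=
  Num.sqrt (dotp u u).

Definition eball (R : realType) (n : nat) (c : 'rV[R]_n) (r : R) :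
  set 'rV[R]_n := [set x | enorm (x - c) < r].

Definition grad (R : realType) (n : nat) (f : 'rV[R]_n -> R) (x : 'rV[R]_n) :
  'rV[R]_n := \row_(i < n) 'd f x (delta_mx 0 i).

Lemma diff_grad (R : realType) (n : nat) (f : 'rV[R]_n -> R)
    (x v : 'rV[R]_n) : 'd f x v = dotp (grad f x) v.
Proof.
rewrite {1}(row_sum_delta v) linear_sum; apply: eq_bigr => i _.
by rewrite linearZ /= mxE mulrC.
Qed.

(* The library Jacobian acts on row vectors from the right, so the Hessian
   applied to v is [v *m hess f x] = 'd (grad f) x v. *)
Definition hess (R : realType) (n : nat) (f : 'rV[R]_n -> R) (x : 'rV[R]_n) :
  'M[R]_n := jacobian (grad f) x.

(* [C1_on] and [C2_on] are meant for an open set U. *)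
Definition C1_on (R : realType) (n : nat) (U : set 'rV[R]_n)
    (f : 'rV[R]_n -> R) : Prop :=
  (forall x, U x -> differentiable f x) /\ {within U, continuous (grad f)}.

Definition C2_on (R : realType) (n : nat) (U : set 'rV[R]_n)
    (f : 'rV[R]_n -> R) : Prop :=
  [/\ C1_on U f,
      (forall x, U x -> differentiable (grad f) x) &
      {within U, continuous (hess f)}].

(* For an extended-real-valued function, being C^1 on U includes being finite
   on U. *)
Definition C1e_on (R : realType) (n : nat) (U : set 'rV[R]_n)
    (h : 'rV[R]_n -> \bar R) : Prop :=
  (forall x, U x -> h x \is a fin_num) /\ C1_on U (fun x => fine (h x)).

Definition holder_gradient (R : realType) (n : nat) (nu L : R)
    (f : 'rV[R]_n -> R) : Prop :=
  forall x y, enorm (grad f y - grad f x) <= L * enorm (y - x) `^ nu.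

(* A function to R ∪ {+oo} is a function to \bar R that avoids -oo. *)
Definition avoids_ninfty (R : realType) (n : nat) (h : 'rV[R]_n -> \bar R) :
  Prop := forall x, h x != -oo%E.

Definition proper_fun (R : realType) (n : nat) (h : 'rV[R]_n -> \bar R) :
  Prop := exists x, h x \is a fin_num.

Definition prox_bounded_at (R : realType) (n : nat) (p : R)
    (g : 'rV[R]_n -> \bar R) (gamma : R) : Prop :=
  0 < gamma /\ exists x : 'rV[R]_n,
    (-oo < ereal_inf
       (range (fun y => g y + ((p * gamma)^-1 * enorm (x - y) `^ p)%:E)))%E.

Definition prox_bounded (R : realType) (n : nat) (p : R)
    (g : 'rV[R]_n -> \bar R) : Prop :=
  exists gamma : R, prox_bounded_at p g gamma.

Definition prox_threshold (R : realType) (n : nat) (p : R)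
    (g : 'rV[R]_n -> \bar R) : \bar R :=
  ereal_sup [set gamma%:E | gamma in [set gamma | prox_bounded_at p g gamma]].

Definition fb_model (R : realType) (n : nat) (f : 'rV[R]_n -> R)
    (g : 'rV[R]_n -> \bar R) (p gamma : R) (x y : 'rV[R]_n) : \bar R :=
  ((f x + dotp (grad f x) (y - x))%:E + g y
   + ((p * gamma)^-1 * enorm (x - y) `^ p)%:E)%E.

Definition fb_envelope (R : realType) (n : nat) (f : 'rV[R]_n -> R)
    (g : 'rV[R]_n -> \bar R) (p gamma : R) (x : 'rV[R]_n) : \bar R :=
  ereal_inf (range (fb_model f g p gamma x)).

Definition fb_splitting (R : realType) (n : nat) (f : 'rV[R]_n -> R)
    (g : 'rV[R]_n -> \bar R) (p gamma : R) (x : 'rV[R]_n) : set 'rV[R]_n :=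
  [set y | forall z, (fb_model f g p gamma x y <= fb_model f g p gamma x z)%E].

Definition single_valued_continuous_on (R : realType) (n : nat)
    (A : set 'rV[R]_n) (T : 'rV[R]_n -> set 'rV[R]_n) : Prop :=
  exists t : 'rV[R]_n -> 'rV[R]_n,
    (forall x, A x -> T x = [set t x]) /\ {within A, continuous t}.

(* Main.v *)
(* A minimizer y of the model at x makes the smooth function
   sigma(., y) + g y, where sigma(x, y) = f x + <grad f x, y - x>
   + |x - y|^p / (p gamma), touch the envelope from above at x.  Hence, if the
   envelope is differentiable at x, its gradient is
   - H(x) u + J(u) / gamma, with u = x - y, H the Hessian of f and
   J(u) = |u|^(p-2) u.  For (a): prox-boundedness keeps u in a fixed ball for all
   x in B(0; r) and all small gamma, and J has a Lipschitz inverse on bounded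
   sets since p <= 2, so for small gamma this relation determines u as a
   continuous function of x.  For (b): comparing the envelope at x and x + h
   with sigma(., t x) and sigma(., t (x + h)) squeezes its increment between
   two first-order expansions with the same linear part; the expansion is
   uniform in y because |.|^p / p is convex with subgradient J. *)
From HB Require Import structures.
Require Import Defs.
From mathcomp Require Import ring lra.

(** * Euclidean geometry *)

Section Euclid.
Context {R : realType} {n : nat}.
Implicit Types (u v w : 'rV[R]_n) (a : R).

Lemma dotpC u v : dotp u v = dotp v u.
Proof. by apply: eq_bigr => i _; rewrite mulrC. Qed.

Lemma dotpDl u v w : dotp (u + v) w = dotp u w + dotp v w.
Proof. by rewrite -big_split; apply: eq_bigr => i _; rewrite mxE mulrDl. Qed.

Lemma dotpZl a u v : dotp (a *: u) v = a * dotp u v.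
Proof. by rewrite mulr_sumr; apply: eq_bigr => i _; rewrite mxE mulrA. Qed.

Lemma dotpDr u v w : dotp u (v + w) = dotp u v + dotp u w.
Proof. by rewrite dotpC dotpDl !(dotpC _ u). Qed.

Lemma dotpZr a u v : dotp u (a *: v) = a * dotp u v.
Proof. by rewrite dotpC dotpZl dotpC. Qed.

Lemma dotpNl u v : dotp (- u) v = - dotp u v.
Proof. by rewrite -scaleN1r dotpZl mulN1r. Qed.

Lemma dotpNr u v : dotp u (- v) = - dotp u v.
Proof. by rewrite dotpC dotpNl dotpC. Qed.

Lemma dotpBl u v w : dotp (u - v) w = dotp u w - dotp v w.
Proof. by rewrite dotpDl dotpNl. Qed.

Lemma dotpBr u v w : dotp u (v - w) = dotp u v - dotp u w.
Proof. by rewrite dotpDr dotpNr. Qed.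

Lemma dotp0l v : dotp 0 v = 0.
Proof. by rewrite -(scale0r 0) dotpZl mul0r. Qed.

Lemma dotp_ge0 u : 0 <= dotp u u.
Proof. by apply: sumr_ge0 => i _; rewrite -expr2 sqr_ge0. Qed.

Lemma sqr_enorm u : enorm u ^+ 2 = dotp u u.
Proof. by rewrite sqr_sqrtr ?dotp_ge0. Qed.

Lemma enorm_ge0 u : 0 <= enorm u.
Proof. exact: sqrtr_ge0. Qed.

Lemma enormZ a u : enorm (a *: u) = `|a| * enorm u.
Proof. by rewrite /enorm dotpZl dotpZr mulrA -expr2 sqrtrM ?sqr_ge0// sqrtr_sqr. Qed.

Lemma enormN u : enorm (- u) = enorm u.
Proof. by rewrite -scaleN1r enormZ normrN1 mul1r. Qed.

Lemma enormC u v : enorm (u - v) = enorm (v - u).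
Proof. by rewrite -enormN opprB. Qed.

Lemma enorm0 : enorm (0 : 'rV[R]_n) = 0.
Proof. by rewrite /enorm dotp0l sqrtr0. Qed.

Lemma normr_le_enorm u : `|u| <= enorm u.
Proof.
rewrite [leLHS]/Num.norm/= mx_normrE; apply: bigmax_le => [|[i j] _] /=.
  exact: enorm_ge0.
rewrite ord1 -sqrtr_sqr /enorm ler_sqrt ?dotp_ge0//.
rewrite /dotp (bigD1 j)//= -expr2 lerDl.
by apply: sumr_ge0 => k _; rewrite -expr2 sqr_ge0.
Qed.

Lemma enorm_eq0 u : enorm u = 0 -> u = 0.
Proof.
by move=> u0; apply/eqP; rewrite -normr_le0 -u0; exact: normr_le_enorm.
Qed.

Lemma enorm_gt0 u : u != 0 -> 0 < enorm u.
Proof.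
by rewrite lt_def enorm_ge0 andbT; apply: contra_neq; exact: enorm_eq0.
Qed.

(** Cauchy-Schwarz: expanding the nonnegative square of [enorm v *: u - enorm u *: v] gives the
    inequality multiplied by [2 * enorm u * enorm v]. *)
Lemma dotp_le u v : dotp u v <= enorm u * enorm v.
Proof.
have [->|v0] := eqVneq v 0; first by rewrite dotpC dotp0l enorm0 mulr0.
have v_gt0 := enorm_gt0 v0.
have [->|u0] := eqVneq u 0; first by rewrite dotp0l enorm0 mul0r.
have u_gt0 := enorm_gt0 u0.
have := dotp_ge0 (enorm v *: u - enorm u *: v).
rewrite dotpBl !dotpBr !dotpZl !dotpZr -!sqr_enorm (dotpC v u) => h.
rewrite -(ler_pM2l (mulr_gt0 u_gt0 v_gt0)).
by nra.
Qed.

Lemma normr_dotp_le u v : `|dotp u v| <= enorm u * enorm v.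
Proof.
by rewrite ler_norml dotp_le andbT lerNl -dotpNl (le_trans (dotp_le _ _))// enormN.
Qed.

Lemma enormD_le u v : enorm (u + v) <= enorm u + enorm v.
Proof.
rewrite -(@ler_pXn2r _ 2)// ?nnegrE ?addr_ge0 ?enorm_ge0//.
rewrite sqr_enorm dotpDl !dotpDr sqrrD !sqr_enorm (dotpC v u).
by have := dotp_le u v; lra.
Qed.

(** The Euclidean norm is at most the sum of the absolute values of the coordinates, each of which
    is at most the max norm. *)
Lemma enorm_le_normr u : enorm u <= n%:R * `|u|.
Proof.
apply: (@le_trans _ _ (\sum_(i < n) `|u 0 i|)).
  rewrite -(@ler_pXn2r _ 2)// ?nnegrE ?enorm_ge0 ?sumr_ge0// sqr_enorm.
  rewrite expr2 mulr_suml; apply: ler_sum => i _.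
  apply: (le_trans (ler_norm _)); rewrite normrM ler_wpM2l//.
  by rewrite (bigD1 i)//= lerDl sumr_ge0.
apply: (@le_trans _ _ (\sum_(i < n) `|u|)).
  apply: ler_sum => i _; rewrite [leRHS]/Num.norm/= mx_normrE.
  exact: (le_bigmax _ (fun k : 'I_1 * 'I_n => `|u k.1 k.2|) (0, i)).
by rewrite sumr_const card_ord mulr_natl.
Qed.

End Euclid.

(** * Topology and differentiation in the Euclidean norm *)

Section EnormTopology.
Context {R : realType} {n : nat}.
Implicit Types (u v w x : 'rV[R]_n).

Lemma nbhs_enormP x (P : set 'rV[R]_n) :
  (\forall y \near x, P y) <->
  exists2 d : R, 0 < d & forall y, enorm (y - x) < d -> P y.
Proof.
split=> [/nbhs_normP[d d0 dP]|[d d0 dP]].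
  exists d => // y yx; apply: dP => /=.
  by rewrite distrC (le_lt_trans (normr_le_enorm _)).
(* [n.+1] rather than [n] keeps the radius positive in dimension 0. *)
apply/nbhs_normP; exists (d / n.+1%:R) => [|y /= yx].
  by rewrite /= divr_gt0.
apply: dP; rewrite (le_lt_trans (enorm_le_normr _))//.
rewrite distrC ltr_pdivlMr// in yx; apply: le_lt_trans yx.
by rewrite mulrC ler_wpM2l// ler_nat.
Qed.

Lemma near_shift0 x (P : set 'rV[R]_n) :
  (\forall y \near x, P y) -> \forall h \near (0 : 'rV[R]_n), P (x + h).
Proof.
move=> /nbhs_enormP[d d0 dP]; apply/nbhs_enormP; exists d => // h.
by rewrite subr0 => hd; apply: dP; rewrite addrC addKr.
Qed.

Lemma cvg_enormP {T : Type} (F : set_system T) {FF : Filter F}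
    (f : T -> 'rV[R]_n) x :
  f @ F --> x <-> forall e : R, 0 < e -> \forall t \near F, enorm (f t - x) < e.
Proof.
split=> [fx e e0|h P /nbhs_enormP[d d0 dP]].
  suff /fx : nbhs x [set y | enorm (y - x) < e] by [].
  by apply/nbhs_enormP; exists e.
by apply: filterS (h d d0) => t; exact: dP.
Qed.

Lemma dist_enorm_le u v : `|enorm u - enorm v| <= enorm (u - v).
Proof.
rewrite ler_norml; have := enormD_le (u - v) v; have := enormD_le (v - u) u.
by rewrite !subrK (enormC v u) => ? ?; apply/andP; split; lra.
Qed.

Lemma cvg_enorm {T : Type} (F : set_system T) {FF : Filter F}
    (f : T -> 'rV[R]_n) x : f @ F --> x -> enorm (f t) @[t --> F] --> enorm x.
Proof.
move=> /cvg_enormP fx; apply/cvgrPdist_lt => e /fx.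
by apply: filterS => t; rewrite enormC; exact/le_lt_trans/dist_enorm_le.
Qed.

Lemma enorm_continuous : continuous (@enorm R n).
Proof.
move=> x; exact: (@cvg_enorm _ (nbhs (x : 'rV[R]_n)) _ id x cvg_id).
Qed.

Lemma cvg_dotp {T : Type} (F : set_system T) {FF : Filter F}
    (f g : T -> 'rV[R]_n) u v : f @ F --> u -> g @ F --> v ->
  dotp (f t) (g t) @[t --> F] --> dotp u v.
Proof.
move=> fu gv; apply: cvg_big => [|i _]; first exact: add_continuous.
have coord := fun z => @coord_continuous R 1 n 0 i z.
apply: cvgM; first exact: (cvg_comp f (fun z => z 0 i) fu (coord u)).
exact: (cvg_comp g (fun z => z 0 i) gv (coord v)).
Qed.

Lemma open_eball x (r : R) : open (eball x r).
Proof.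
rewrite openE => y /= yr; apply/nbhs_enormP; exists (r - enorm (y - x)).
  by rewrite subr_gt0.
move=> z zy; rewrite /eball/= -(subrK y z) -addrA.
by rewrite (le_lt_trans (enormD_le _ _))// -ltrBrDr.
Qed.

Lemma closure_eball_le (c : 'rV[R]_n) (r : R) x :
  closure (eball c r) x -> enorm (x - c) <= r.
Proof.
move=> xr; apply/ler_addgt0Pr => e e0.
have /xr[y [/= yr yx]] : nbhs x [set y | enorm (y - x) < e].
  by apply/nbhs_enormP; exists e.
have -> : x - c = x - y + (y - c) by rewrite addrA subrK.
by rewrite (le_trans (enormD_le _ _))// addrC lerD// ltW// enormC.
Qed.

Lemma compact_closure_eball (c : 'rV[R]_n) (r : R) : compact (closure (eball c r)).
Proof.
apply: bounded_closed_compact; last exact: closed_closure.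
exists (r + enorm c); split; first exact: num_real.
move=> M rM x /closure_eball_le xr /=.
rewrite (le_trans (normr_le_enorm _))// -(subrK c x).
by rewrite (le_trans (enormD_le _ _))// (le_trans _ (ltW rM))// lerD2r.
Qed.

End EnormTopology.

(** * First-order expansions and symmetry of the Hessian *)

Section Differentiation.
Context {R : realType}.

Lemma near_jacobian {n m : nat} (F : 'rV[R]_n -> 'rV[R]_m) x (e : R) :
  differentiable F x -> 0 < e ->
  \forall h \near (0 : 'rV[R]_n),
    enorm (F (x + h) - F x - h *m jacobian F x) <= e * enorm h.
Proof.
move=> dF e0; have /diff_locally/eqaddoP/(_ (e / m.+1%:R)) := dF.
rewrite divr_gt0// => /(_ isT); apply: filterS => h hh.
rewrite /jacobian mul_rV_lin1/= -addrA -opprD [x + h]addrC.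
rewrite (le_trans (enorm_le_normr _))//.
apply: (@le_trans _ _ (m.+1%:R * (e / m.+1%:R * `|h|))).
  by rewrite ler_pM// ler_nat.
by rewrite mulrA [m.+1%:R * _]mulrC divfK// ler_wpM2l ?normr_le_enorm// ltW.
Qed.

Context {n : nat}.
Implicit Types (f : 'rV[R]_n -> R) (x v h : 'rV[R]_n).

Lemma near_grad f x (e : R) : differentiable f x -> 0 < e ->
  \forall h \near (0 : 'rV[R]_n), `|f (x + h) - f x - dotp (grad f x) h| <= e * enorm h.
Proof.
move=> df e0; have /diff_locally/eqaddoP/(_ e e0) := df.
apply: filterS => h; rewrite [x + h]addrC -diff_grad -addrA -opprD => /le_trans.
by apply; rewrite ler_wpM2l ?normr_le_enorm// ltW.
Qed.

(** Converse of [near_grad]: the expansion says that the continuous linear form [dotp v] is a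
    Fréchet derivative at [x], and such a derivative is unique. *)
Lemma grad_unique f x v :
  (forall e : R, 0 < e ->
    \forall h \near (0 : 'rV[R]_n), `|f (x + h) - f x - dotp v h| <= e * enorm h) ->
  differentiable f x /\ grad f x = v.
Proof.
move=> fv.
have dl : linear (dotp v : 'rV[R]_n -> R).
  by move=> a y z; rewrite dotpDr dotpZr.
pose dfl := GRing.isLinear.Build _ _ _ _ (dotp v : 'rV[R]_n -> R) dl.
pose df : {linear 'rV[R]_n -> R} := HB.pack (dotp v : 'rV[R]_n -> R) dfl.
have cdf : continuous df.
  move=> y; apply: (@cvg_dotp _ _ _ (nbhs (y : 'rV[R]_n)) _ (fun=> v) id v y).
    exact: cvg_cst.
  exact: cvg_id.
have fo (e : R) : 0 < e -> \forall h \near (0 : 'rV[R]_n),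
    `|f (h + x) - (f x + dotp v h)| <= e * `|h|.
  move=> e0; have /fv : 0 < e / n.+1%:R by rewrite divr_gt0.
  apply: filterS => h; rewrite [x + h]addrC -addrA -opprD => /le_trans; apply.
  rewrite -mulrA ler_pM2l// ler_pdivrMl// (le_trans (enorm_le_normr _))//.
  by rewrite ler_wpM2r// ler_nat.
have dfE : 'd f x = df :> (_ -> _).
  by apply: diff_unique => //; apply/eqaddoP => e /fo.
have fd : differentiable f x.
  apply/diff_locallyP; rewrite dfE; split=> //.
  by apply/eqaddoP => e /fo.
split=> //; apply/rowP => i; rewrite mxE dfE/=.
by rewrite /dotp (bigD1 i)//= big1 ?addr0 => [|j /negPf ji];
  rewrite mxE ?eqxx/= ?mulr1// ji mulr0.
Qed.

(* A linear form that is nonpositive up to [o(h)] vanishes. *)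
Lemma grad_upper f x v : differentiable f x ->
  (forall e : R, 0 < e ->
    \forall h \near (0 : 'rV[R]_n), f (x + h) - f x - dotp v h <= e * enorm h) ->
  grad f x = v.
Proof.
move=> df fv; apply/eqP; rewrite -subr_eq0; apply/negPn/negP => w0.
set w := grad f x - v in w0; have w_gt0 := enorm_gt0 w0.
have e0 : 0 < enorm w / 4 by rewrite divr_gt0.
have /nbhs_enormP[d d0 hd] : \forall h \near (0 : 'rV[R]_n),
    `|f (x + h) - f x - dotp (grad f x) h| <= enorm w / 4 * enorm h /\
    f (x + h) - f x - dotp v h <= enorm w / 4 * enorm h.
  by apply: filterI; [exact: near_grad|exact: fv].
(* Test along [w] with a step of length [d / 2]: the two estimates bound [dotp w (s *: w)] by
   [enorm w * d / 4], while its value is [enorm w * d / 2]. *)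
pose s := d / 2 / enorm w.
have s0 : 0 < s by rewrite !divr_gt0.
have swE : enorm (s *: w) = d / 2 by rewrite enormZ gtr0_norm// divfK ?gt_eqF.
have [] := hd (s *: w).
  by rewrite subr0 swE ltr_pdivrMr// ltr_pMr// ltr1n.
rewrite swE ler_norml => /andP[h1 _] h2.
have : dotp w (s *: w) = dotp (grad f x) (s *: w) - dotp v (s *: w).
  by rewrite dotpBl.
rewrite dotpZr -sqr_enorm expr2 mulrA divfK ?gt_eqF//.
by have := mulr_gt0 d0 w_gt0; lra.
Qed.

Lemma is_derive_line f x v (t : R) : (forall y, differentiable f y) ->
  is_derive t 1 (fun s : R => f (x + s *: v)) (dotp (grad f (x + t *: v)) v).
Proof.
move=> df; rewrite -diff_grad.
have dg : is_diff t (fun s : R => x + s *: v) (fun s => s *: v).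
  have -> : (fun s : R => s *: v) = \0 + (fun s => s *: v).
    by apply/funext => s; rewrite !fctE add0r.
  exact: is_diffD.
have dfx := differentiableP (df (x + t *: v)).
have dfg := is_diff_comp dg dfx.
apply: DeriveDef; first by apply/derivable1_diffP; exact: ex_diff.
by rewrite deriveE; [rewrite diff_val/= scale1r|exact: ex_diff].
Qed.

Fact subr_cancel2 (V : zmodType) (a b c d e : V) :
  a - b - (c + d) - (e - b - c) = a - e - d.
Proof.
apply/eqP; rewrite subr_eq addrACA [a - e + _]addrA subrK -opprD.
by rewrite (addrC d).
Qed.

(* Mean value theorem for [fun t => f (x + s *: k + t *: h) - f (x + t *: h)];
   the left-hand side is symmetric in [h] and [k], hence so is the Hessian. *)
Lemma second_difference f x h k (e : R) : (forall y, differentiable f y) ->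
  differentiable (grad f) x -> 0 < e ->
  exists2 d : R, 0 < d & forall s : R, 0 < s < d ->
    `|f (x + s *: k + s *: h) - f (x + s *: h) - (f (x + s *: k) - f x)
      - s ^+ 2 * dotp (k *m hess f x) h| <= e * s ^+ 2.
Proof.
move=> df ddf e0.
(* Steps along [h] and [k] with coefficients in [0, s] have length at most [s * M]. Two Jacobian
   remainders [e' * (s * M)], paired with [h] and multiplied by [s], then add up to at most
   [e * s ^+ 2]. *)
pose M := enorm h + enorm k + 1.
have M0 : 0 < M by rewrite ltr_wpDl// addr_ge0// enorm_ge0.
pose e' := e / (2 * M * M).
have e'0 : 0 < e' by rewrite divr_gt0// !mulr_gt0.
have /nbhs_enormP[d d0 hd] := near_jacobian ddf e'0.
exists (d / M) => [|s /andP[s0 sd]]; first exact: divr_gt0.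
pose phi (t : R) := f (x + s *: k + t *: h) - f (x + t *: h).
pose dphi (t : R) := dotp (grad f (x + s *: k + t *: h) - grad f (x + t *: h)) h.
have phi_derive (t : R) : is_derive t 1 phi (dphi t).
  rewrite /dphi dotpBl; apply: is_deriveB; exact: is_derive_line.
have [|c] := @MVT R phi dphi 0 s s0 (fun t _ => phi_derive t).
  apply: derivable_within_continuous => t _.
  by have [] := phi_derive t.
rewrite in_itv/= => /andP[c0 cs]; rewrite /phi !scale0r !addr0 subr0 => ->.
have small a b : enorm (a *: h + b *: k) <= s * M -> enorm (a *: h + b *: k) < d.
  by move=> /le_lt_trans; apply; rewrite -ltr_pdivlMr.
have bnd b : 0 <= b <= s -> enorm (c *: h + b *: k) <= s * M.
  move=> /andP[b0 bs]; rewrite (le_trans (enormD_le _ _))//.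
  rewrite !enormZ !ger0_norm ?(ltW c0)//.
  have := enorm_ge0 h; have := enorm_ge0 k; rewrite /M; nra.
have b1 : enorm (c *: h + s *: k) <= s * M by rewrite bnd// lexx ltW.
have b0 : enorm (c *: h + 0 *: k) <= s * M by rewrite bnd// lexx ltW.
have := hd (c *: h + s *: k); rewrite subr0 => /(_ (small _ _ b1)) h1.
have := hd (c *: h + 0 *: k); rewrite subr0 => /(_ (small _ _ b0)) h0.
set a1 := (X in enorm X <= _) in h1; set a0 := (X in enorm X <= _) in h0.
(* In the difference of the two expansions of [grad f] at [x], the value at [x] and the contribution
   of [c *: h] cancel; only [s *: k] remains. *)
have dphiE : dphi c * s - s ^+ 2 * dotp (k *m hess f x) h = s * dotp (a1 - a0) h.
  have -> : a1 - a0 = grad f (x + s *: k + c *: h) - grad f (x + c *: h)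
                      - s *: (k *m hess f x).
    rewrite /a1 /a0 scale0r addr0 mulmxDl -scalemxAl -/(hess f x).
    rewrite (addrC (c *: h) (s *: k)) addrA -!scalemxAl.
    set A := grad f _; set B := grad f _; set C := _ *: (h *m _); set D := _ *: _.
    set E := grad f (x + c *: h).
    move: A B C D E => A B C D E; exact: subr_cancel2.
  by rewrite [RHS]mulrC dotpBl dotpZl -/(dphi c); ring.
rewrite dphiE normrM gtr0_norm//.
have ha : enorm (a1 - a0) <= e / M * s.
  rewrite (le_trans (enormD_le _ _))// enormN.
  have -> : e / M * s = e' * (s * M) + e' * (s * M).
    by rewrite /e'; field; rewrite gt_eqF.
  by rewrite lerD// ?(le_trans h1)// ?(le_trans h0)// ler_pM2l.
rewrite expr2 mulrA [e * s]mulrC -!mulrA ler_pM2l//.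
rewrite (le_trans (normr_dotp_le _ _))//.
apply: (@le_trans _ _ (e / M * s * M)); last by rewrite mulrAC divfK ?gt_eqF.
by rewrite ler_pM ?enorm_ge0// /M; have := enorm_ge0 k; lra.
Qed.

(** Both sides, multiplied by [s ^+ 2], lie within [e / 2 * s ^+ 2] of the same second
    difference. *)
Lemma hess_sym f x u v : (forall y, differentiable f y) ->
  differentiable (grad f) x ->
  dotp (u *m hess f x) v = dotp (v *m hess f x) u.
Proof.
move=> df ddf; apply/eqP; rewrite -subr_eq0 -normr_le0.
apply/ler_addgt0Pr => e e0; rewrite add0r.
have e20 : 0 < e / 2 by rewrite divr_gt0.
have [d1 d10 h1] := second_difference v u df ddf e20.
have [d2 d20 h2] := second_difference u v df ddf e20.
pose d := Num.min d1 d2; have d0 : 0 < d by rewrite lt_min d10.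
pose s := d / 2; have s0 : 0 < s by rewrite divr_gt0.
have sd : s < d by rewrite ltr_pdivrMr// ltr_pMr// ltr1n.
have := h1 s; have := h2 s; rewrite s0/=.
move: (sd); rewrite lt_min => /andP[-> ->] /(_ isT) k2 /(_ isT) k1.
have s20 : 0 < s ^+ 2 by rewrite exprn_gt0.
rewrite -(ler_pM2l s20) -[s ^+ 2 in leLHS]gtr0_norm// -normrM mulrBr.
move: k1 k2; rewrite (addrAC x (s *: v)) !ler_norml => /andP[p1 p2] /andP[p3 p4].
by apply/andP; split; lra.
Qed.

End Differentiation.

(** * Powers and the map J *)

(** A form of Bernoulli's inequality, by induction on the exponent. *)
Lemma sub1X_le {R : realType} (N : nat) (s : R) :
  0 <= s <= 1 -> 1 - s ^+ N <= N%:R * (1 - s).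
Proof.
move=> /andP[s0 s1]; elim: N => [|N IH]; first by rewrite expr0 subrr mul0r.
have := exprn_ile1 N s0 s1; have := exprn_ge0 N s0.
rewrite exprS -natr1; nra.
Qed.

Lemma powR_le1 {R : realType} (t y : R) : 0 <= t <= 1 -> 0 <= y -> t `^ y <= 1.
Proof.
move=> /andP[t0 t1] y0; have := ge0_ler_powR y0 _ _ t1.
by rewrite powR1; apply; rewrite nnegrE.
Qed.

(** The sum is at most twice the larger term, and the factor 2 raised to the power [p] is at most
    4. *)
Lemma powRD_le {R : realType} (p a b : R) : 0 <= p <= 2 -> 0 <= a -> 0 <= b ->
  (a + b) `^ p <= 4 * (a `^ p + b `^ p).
Proof.
move=> /andP[p0 p2]; wlog ab : a b / a <= b => [hw a0 b0|a0 b0].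
  have [|/ltW] := leP a b; first by move=> /hw; exact.
  by move=> /hw; rewrite addrC (addrC (a `^ p)); exact.
apply: (@le_trans _ _ ((2 * b) `^ p)).
  rewrite ge0_ler_powR// ?nnegrE ?addr_ge0 ?mulr_ge0//.
  by rewrite mulr_natl mulr2n lerD2r.
rewrite powRM// (@le_trans _ _ (4 * b `^ p))//.
  rewrite ler_wpM2r ?powR_ge0// (@le_trans _ _ (2 `^ 2%:R))//.
    by rewrite ler_powR// ler1n.
  by rewrite powR_mulrn// -natrX.
by rewrite ler_pM2l// lerDr powR_ge0.
Qed.

(** Superlinear growth: if [s > 1], then [B * s + A] is at most [s * (A + B)], and dividing by [s]
    bounds the power [p - 1] of [s]. *)
Lemma powR_affine_bound {R : realType} (p s A B : R) : 1 < p ->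
  0 <= s -> 0 <= A -> s `^ p <= B * s + A ->
  s <= 1 + (A + B) `^ (p - 1)^-1.
Proof.
move=> p1 s0 A0 sp; have [s1|s1] := leP s 1.
  by rewrite (le_trans s1)// lerDl powR_ge0.
have p10 : 0 < p - 1 by rewrite subr_gt0.
have sAB : s `^ (p - 1) <= A + B.
  rewrite -(ler_pM2l (lt_trans ltr01 s1)) mulr_powRB1// ?(lt_trans _ p1)//.
  by rewrite (le_trans sp)//; nra.
have sE : s = (s `^ (p - 1)) `^ (p - 1)^-1.
  by rewrite -powRrM mulfV ?powRr1// gt_eqF.
rewrite [leLHS]sE ler_wpDl// ge0_ler_powR// ?invr_ge0 ?ltW// ?nnegrE ?powR_ge0//.
by rewrite (le_trans _ sAB)// powR_ge0.
Qed.

Section DualityMap.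
Context {R : realType} {n : nat} (p : R) (p1 : 1 < p).
Implicit Types (u v : 'rV[R]_n).

(* [0 `^ (p - 2)] is [0] or [1], so [dmap 0 = 0] as in the paper's convention. *)
Definition dmap u : 'rV[R]_n := enorm u `^ (p - 2) *: u.

Let p0 : 0 < p. Proof. exact: lt_trans p1. Qed.
Let p10 : 0 < p - 1. Proof. by rewrite subr_gt0. Qed.

Lemma enorm_dmap u : enorm (dmap u) = enorm u `^ (p - 1).
Proof.
rewrite /dmap enormZ ger0_norm ?powR_ge0// mulrC.
by rewrite -(mulr_powRB1 (enorm_ge0 u) p10); congr (_ * _ `^ _); ring.
Qed.

Lemma dotp_dmap u : dotp (dmap u) u = enorm u `^ p.
Proof.
rewrite /dmap dotpZl -sqr_enorm -(mulr_powRB1 (enorm_ge0 u) p0).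
rewrite -(mulr_powRB1 (enorm_ge0 u) p10) expr2 mulrC -mulrA.
by congr (_ * (_ * _ `^ _)); ring.
Qed.

(* [dmap u] is the gradient of the convex function [enorm u `^ p / p]. *)
Lemma powR_enorm_convex u v :
  dotp (dmap u) (v - u) <= enorm v `^ p / p - enorm u `^ p / p.
Proof.
rewrite dotpBr dotp_dmap.
have q0 : 0 < p / (p - 1) by rewrite divr_gt0.
have pq : p^-1 + (p / (p - 1))^-1 = 1.
  by field; rewrite !gt_eqF.
(* Young's inequality with the conjugate exponents [p] and [p / (p - 1)], to be combined with
   Cauchy-Schwarz. *)
have := conjugate_powR (enorm_ge0 v) (powR_ge0 (enorm u) (p - 1)) p0 q0 pq.
rewrite -powRrM [(p - 1) * _]mulrC divfK ?gt_eqF// => h.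
have := dotp_le (dmap u) v; rewrite enorm_dmap mulrC => /le_trans/(_ h) {}h.
apply: (le_trans (lerB h (lexx _))).
rewrite -addrA lerD2l le_eqVlt; apply/orP; left; apply/eqP.
by field; rewrite !gt_eqF.
Qed.

(** The exponent [p - 2] may be negative, so the origin is treated apart: there the norm of [dmap]
    is a positive power of [enorm]. Elsewhere [dmap] is a product of continuous maps. *)
Lemma dmap_continuous : continuous dmap.
Proof.
move=> u; have [->|u0] := eqVneq u 0.
  apply/(@cvg_enormP _ _ _ (nbhs (0 : 'rV[R]_n))) => e e0.
  rewrite /dmap scaler0.
  apply/nbhs_enormP; exists (e `^ (p - 1)^-1) => [|v]; first exact: powR_gt0.
  rewrite !subr0 -/(dmap v) enorm_dmap => ve.
  have -> : e = (e `^ (p - 1)^-1) `^ (p - 1).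
    by rewrite -powRrM mulVf ?powRr1// ?ltW// gt_eqF.
  by rewrite gt0_ltr_powR// nnegrE ?enorm_ge0 ?powR_ge0.
have eu := enorm_gt0 u0.
suff h : enorm v `^ (p - 2) @[v --> (u : 'rV[R]_n)] --> enorm u `^ (p - 2).
  exact: (cvgZ h cvg_id).
apply: (cvg_comp (@enorm R n) (fun t => t `^ (p - 2)) (G := nbhs (enorm u))).
  exact: enorm_continuous.
have /differentiable_continuous :
    differentiable (fun t : R => t `^ (p - 2) : R^o) (enorm u).
  by apply/derivable1_diffP/derivable_powR; rewrite in_itv/= eu.
exact.
Qed.

Lemma dmapK u : p <= 2 -> enorm u `^ (2 - p) *: dmap u = u.
Proof.
move=> p2; have [->|u0] := eqVneq u 0; first by rewrite /dmap !scaler0.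
rewrite scalerA -powRD; last by rewrite (gt_eqF (enorm_gt0 u0)) implybT.
by rewrite (_ : 2 - p + (p - 2) = 0) ?powRr0 ?scale1r//; ring.
Qed.

(* [u] is recovered as [enorm u `^ (2 - p) *: dmap u] with an exponent
   [2 - p >= 0]; with [s = (enorm v / enorm u) `^ (p - 1)] everything reduces to
   Bernoulli's inequality for [s ^+ N], where [2 - p <= N * (p - 1)]. *)
Lemma dmap_inverse_lipschitz (C : R) : p <= 2 -> 0 < C ->
  exists2 K : R, 0 < K & forall u v, enorm u <= C -> enorm v <= C ->
    enorm (u - v) <= K * enorm (dmap u - dmap v).
Proof.
(* [N] exceeds the ratio of [2 - p] to [p - 1], so for [t] in [0, 1] the power [s ^+ N] lies below
   the power [2 - p] of [t]. *)
move=> p2 C0; pose N := (Num.truncn ((2 - p) / (p - 1))).+1.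
exists (C `^ (2 - p) * (1 + N%:R)) => [|u v].
  by rewrite mulr_gt0 ?powR_gt0// addr_gt0.
wlog vu : u v / enorm v <= enorm u => [hw uC vC|uC vC].
  have [|/ltW] := leP (enorm v) (enorm u); first by move=> /hw; exact.
  by move=> /hw/(_ vC uC); rewrite enormC (enormC (dmap v)).
have [u0|/enorm_gt0 u0] := eqVneq u 0.
  have v0 : v = 0.
    by apply: enorm_eq0; apply: le_anti; rewrite enorm_ge0 (le_trans vu)// u0 enorm0.
  by rewrite u0 v0 !subrr enorm0 mulr0.
set a := enorm u in uC vu u0; set b := enorm v in vC vu.
have b0 : 0 <= b := enorm_ge0 v.
pose t := b / a; have t0 : 0 <= t by rewrite divr_ge0// ltW.
have t1 : t <= 1 by rewrite ler_pdivrMr// mul1r.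
have bE y : b `^ y = a `^ y * t `^ y.
  by rewrite -powRM ?(ltW u0)// /t mulrC divfK ?gt_eqF.
pose s := t `^ (p - 1); have s0 : 0 <= s by exact: powR_ge0.
have s1 : s <= 1.
  by rewrite powR_le1 ?t0// ltW.
have sN : s ^+ N <= t `^ (2 - p).
  have [te0|tn0] := eqVneq t 0.
    by rewrite /s te0 powR0 ?gt_eqF// expr0n/= powR_ge0.
  rewrite -powR_mulrn// /s -powRrM ger_powR ?t1 ?andbT ?lt_def ?tn0//.
  by rewrite mulrC -ler_pdivrMr//; apply/ltW/truncnS_gt.
have key : (1 - t `^ (2 - p)) * s <= N%:R * (1 - s).
  have := @sub1X_le R N s; rewrite s0 s1 => /(_ isT).
  have : t `^ (2 - p) <= 1.
    by rewrite powR_le1 ?t0// subr_ge0.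
  nra.
have ab : 0 <= a `^ (2 - p) - b `^ (2 - p).
  by rewrite subr_ge0 ge0_ler_powR// ?subr_ge0// nnegrE// ltW.
(* Both vectors are recovered by [dmapK]. The first summand is already Lipschitz in [dmap]; the
   second carries the difference of the scalar factors, which [key] controls. *)
have -> : u - v = a `^ (2 - p) *: (dmap u - dmap v)
                  + (a `^ (2 - p) - b `^ (2 - p)) *: dmap v.
  by rewrite scalerBr scalerBl addrA subrK !dmapK.
rewrite (le_trans (enormD_le _ _))// (enormZ (_ - _) (dmap v)).
rewrite (enormZ _ (_ - _)) (ger0_norm ab) ger0_norm ?powR_ge0//.
rewrite enorm_dmap -/b.
set D := enorm (_ - _).
have sub : a `^ (p - 1) - b `^ (p - 1) <= D.
  by rewrite /a /b -!enorm_dmap (le_trans (ler_norm _))// dist_enorm_le.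
have D0 : 0 <= D := enorm_ge0 _.
apply: (@le_trans _ _ (a `^ (2 - p) * (1 + N%:R) * D)); last first.
  rewrite ler_wpM2r// ler_wpM2r ?addr_ge0//.
  by rewrite ge0_ler_powR// ?subr_ge0// nnegrE// ltW.
rewrite -[_ * (1 + _) * D]mulrA [(1 + _) * D]mulrDl mul1r mulrDr lerD2l.
apply: (@le_trans _ _ (a `^ (2 - p) * (N%:R * (a `^ (p - 1) - b `^ (p - 1))))).
  rewrite !bE -/s.
  have a1 := powR_ge0 a (2 - p); have a2 := powR_ge0 a (p - 1).
  have := ler_wpM2l (mulr_ge0 a1 a2) key; nra.
by rewrite ler_wpM2l ?powR_ge0// ler_wpM2l.
Qed.

End DualityMap.

(** * Lower semicontinuity and the smooth part of the model *)

Section LowerSemicontinuity.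
Context {R : realType}.

Lemma seq_min (s : seq R) : s != [::] ->
  exists2 a, a \in s & forall b, b \in s -> a <= b.
Proof.
elim: s => // a [|b s] IH _.
  by exists a => [|c]; rewrite inE// => /eqP->.
have [//|c cs cmin] := IH.
have [ac|ca] := leP a c.
  exists a => [|d]; first exact: mem_head.
  by rewrite inE => /predU1P[->//|/cmin]; exact: le_trans.
exists c => [|d]; first by rewrite inE cs orbT.
by rewrite inE => /predU1P[->|/cmin//]; exact: ltW.
Qed.

(** By contradiction: without a minimum, the open sets where [h] exceeds one of its real values on
    [K] cover [K]. In a finite subcover the least such value is attained at a point of [K] that no
    member covers. *)
Lemma lower_semicontinuous_compact_min (T : ptopologicalType)
    (h : T -> \bar R) (K : set T) : compact K -> K !=set0 ->
  lower_semicontinuous h -> (forall x, h x != -oo%E) ->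
  exists2 c, K c & forall z, K z -> (h c <= h z)%E.
Proof.
move=> cK [x0 Kx0] /lower_semicontinuousP hlsc hNy.
apply: contrapT => nomin.
have lower y : K y -> exists2 z, K z & (h z < h y)%E.
  move=> Ky; apply: contrapT => noz; apply: nomin; exists y => // z Kz.
  by rewrite leNgt; apply/negP => zy; apply: noz; exists z.
pose D := [set a : R | exists2 z, K z & h z = a%:E].
have := cK; rewrite compact_cover.
move=> /(_ R D (fun a => [set x | (a%:E < h x)%E]))[].
- by move=> a _; exact: hlsc.
- move=> y /lower[z Kz zy]; exists (fine (h z)) => /=.
    by exists z => //; rewrite fineK// fin_numE hNy/= lt_eqF// (lt_le_trans zy)// leey.
  by rewrite fineK// fin_numE hNy/= lt_eqF// (lt_le_trans zy)// leey.
move=> D' D'D cov; have [a0 a0D' _] := cov _ Kx0.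
have [|a aD' amin] := @seq_min (finmap.enum_fset D').
  apply/negP => /eqP D'0; move: a0D'.
  by rewrite /= -[_ \in _]/(a0 \in finmap.enum_fset D') D'0.
have [z Kz za] : D a by have := D'D _ aD'; rewrite inE.
have [b bD' /=] := cov _ Kz; rewrite za lte_fin.
by rewrite ltNge amin.
Qed.

Lemma lower_semicontinuous_addr (T : topologicalType) (h : T -> \bar R)
    (c : T -> R) : lower_semicontinuous h -> (forall x, h x != -oo%E) ->
  continuous c -> lower_semicontinuous (fun x => h x + (c x)%:E)%E.
Proof.
move=> hlsc hNy cc x a ax.
(* The threshold [a] is split between [h] and [c]: half of the slack goes to each if [h x] is
   finite, and any [b] above [a - c x] serves if it is infinite. *)
have [b bh bc] : exists2 b : R, (b%:E < h x)%E & a - b < c x.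
  case: (h x) (hNy x) ax => [r| |]// _.
    rewrite -EFinD lte_fin => ax.
    by exists (r - (r + c x - a) / 2); [rewrite lte_fin|]; lra.
  by move=> _; exists (a - c x + 1); [exact: ltry|lra].
have [V Vx Vb] := hlsc x b bh.
exists (V `&` [set y | a - b < c y]).
  apply: filterI => //; have /cvgr_gt := cc x; exact.
move=> y [Vy /= cy]; have := Vb y Vy.
case: (h y) => [s| |]//=; last by rewrite addye// => _; exact: ltry.
by rewrite -EFinD !lte_fin; lra.
Qed.

End LowerSemicontinuity.

(** * Norm bound and continuity of the vector-matrix product *)

Section Operator.
Context {R : realType} {n : nat}.
Implicit Types (u v : 'rV[R]_n) (A B : 'M[R]_n).

Lemma enorm_mulmx_le v A : enorm (v *m A) <= n%:R * n%:R * `|A| * enorm v.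
Proof.
have h : `|v *m A| <= n%:R * (`|v| * `|A|).
  rewrite [leLHS]/Num.norm/= mx_normrE.
  apply: bigmax_le => [|[i j] _] /=; first by rewrite !mulr_ge0.
  rewrite mxE (le_trans (ler_norm_sum _ _ _))//.
  apply: (@le_trans _ _ (\sum_(k < n) `|v| * `|A|)); last first.
    by rewrite sumr_const card_ord mulr_natl.
  apply: ler_sum => k _; rewrite normrM ler_pM//.
    rewrite [leRHS]/Num.norm/= mx_normrE.
    exact: (le_bigmax _ (fun l : 'I_1 * 'I_n => `|v l.1 l.2|) (i, k)).
  rewrite [leRHS]/Num.norm/= mx_normrE.
  exact: (le_bigmax _ (fun l : 'I_n * 'I_n => `|A l.1 l.2|) (k, j)).
rewrite (le_trans (enorm_le_normr _))// -!mulrA ler_wpM2l// (le_trans h)//.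
by rewrite ler_wpM2l// mulrC ler_wpM2l// normr_le_enorm.
Qed.

Lemma cvg_mulmx {T : Type} (F : set_system T) {FF : Filter F}
    (f : T -> 'rV[R]_n) (M : T -> 'M[R]_n) u A :
  f @ F --> u -> M @ F --> A -> (f t *m M t) @[t --> F] --> u *m A.
Proof.
move=> /cvg_enormP fu /cvgrPdist_lt MA; apply/cvg_enormP => e e0.
pose c := n%:R * n%:R : R; have c0 : 0 <= c by rewrite mulr_ge0.
(* The last summand 1 makes the final bound equal to [e - e / b], strictly below [e]. *)
pose b := c * (`|A| + 1) + c * enorm u + 1.
have b0 : 0 < b by rewrite ltr_wpDl// addr_ge0// mulr_ge0 ?addr_ge0 ?enorm_ge0.
have eb0 : 0 < e / b by rewrite divr_gt0.
near=> t.
have -> : f t *m M t - u *m A = (f t - u) *m M t - u *m (A - M t).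
  by rewrite mulmxBl mulmxBr opprB addrA subrK.
have ft : enorm (f t - u) < e / b by near: t; exact: fu.
have Mt1 : `|A - M t| < 1 by near: t; exact: MA.
have Mt : `|A - M t| < e / b by near: t; exact: MA.
have Mb : `|M t| <= `|A| + 1.
  by rewrite -[M t](subKr A) (le_trans (ler_normB _ _))// lerD2l ltW.
rewrite (le_lt_trans (enormD_le _ _))// enormN.
apply: (@le_lt_trans _ _ (c * (`|A| + 1) * (e / b) + c * (e / b) * enorm u)).
  rewrite lerD// (le_trans (enorm_mulmx_le _ _))// -/c.
    by rewrite ler_pM ?mulr_ge0 ?enorm_ge0// ?ler_wpM2l// ltW.
  by rewrite ler_wpM2r ?enorm_ge0// ler_wpM2l// ltW.
have -> : c * (`|A| + 1) * (e / b) + c * (e / b) * enorm u = e - e / b.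
  pose k := e / b; have ek : e = k * b by rewrite /k divfK// gt_eqF.
  by rewrite -/k ek /b; ring.
by rewrite ltrBlDr ltrDl.
Unshelve. all: by end_near. Qed.

End Operator.

(** * The smooth part of the model and its expansion in the base point *)

Fact expansion_split {R : realType} {n : nat} (f1 f0 q1 q0 r : R)
    (G1 G0 H z h w : 'rV[R]_n) :
  f1 + dotp G1 z + q1 - (f0 + dotp G0 (z + h) + q0)
    - (dotp H z - dotp H w + r) =
  f1 - f0 - dotp G0 h + dotp (G1 - G0 - H) z + dotp H w + (q1 - q0 - r).
Proof. by rewrite !dotpBl dotpDr; ring. Qed.

Fact norm_sandwich {R : realType} (q1 q0 d d1 d0 E : R) :
  d0 <= q1 - q0 -> - d1 <= q0 - q1 -> - E <= d0 - d -> d1 - d <= E ->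
  `|q1 - q0 - d| <= E.
Proof. by move=> *; rewrite ler_norml; apply/andP; split; lra. Qed.

Section Model.
Context {R : realType} {n : nat} (f : 'rV[R]_n -> R) (g : 'rV[R]_n -> \bar R).
Context (p gamma : R) (p1 : 1 < p) (gamma0 : 0 < gamma).
Context (fdiff : forall x, differentiable f x).
Implicit Types (x y z h : 'rV[R]_n).

Definition smooth_model x y : R :=
  f x + dotp (grad f x) (y - x) + (p * gamma)^-1 * enorm (x - y) `^ p.

(** The gradient of [smooth_model] in [x] with [y] fixed: [grad f x] occurs once from [f x] and
    once, with the opposite sign, from the inner product, and cancels. *)
Definition smooth_model_grad x y : 'rV[R]_n :=
  (y - x) *m hess f x + gamma^-1 *: dmap p (x - y).

Lemma fb_modelE x y : fb_model f g p gamma x y = (g y + (smooth_model x y)%:E)%E.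
Proof. by rewrite /fb_model addeAC -EFinD addeC. Qed.

Lemma prox_term_convex (u v : 'rV[R]_n) :
  gamma^-1 * dotp (dmap p u) (v - u) <=
  (p * gamma)^-1 * enorm v `^ p - (p * gamma)^-1 * enorm u `^ p.
Proof.
have := @powR_enorm_convex _ n _ p1 u v.
rewrite -(ler_pM2l (_ : 0 < gamma^-1)) ?invr_gt0// => /le_trans; apply.
by rewrite mulrBr invfM ![_ / p]mulrC !mulrA ![_^-1 * p^-1]mulrC.
Qed.

(* The prox term is handled by convexity alone, through the subgradient
   inequalities at both ends, which is uniform in the second variable. *)
Lemma smooth_model_expansion x y (Y : 'rV[R]_n -> 'rV[R]_n) (e : R) :
  differentiable (grad f) x -> Y h @[h --> (0 : 'rV[R]_n)] --> y -> 0 < e ->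
  \forall h \near (0 : 'rV[R]_n),
    `|smooth_model (x + h) (Y h) - smooth_model x (Y h)
      - dotp (smooth_model_grad x y) h| <= e * enorm h.
Proof.
move=> ddf Yy e0.
pose MH := n%:R * n%:R * `|hess f x|.
have MH0 : 0 <= MH by rewrite !mulr_ge0.
have gi0 : 0 < gamma^-1 by rewrite invr_gt0.
(* [B] collects the coefficients of the four error terms below: 1, [enorm (y - x) + 1], [MH] and
   [gamma^-1]. *)
pose B := enorm (y - x) + 2 + MH + gamma^-1.
have B0 : 0 < B by rewrite /B; have := enorm_ge0 (y - x); lra.
pose e' := e / B; have e'0 : 0 < e' by rewrite divr_gt0.
have idc : h @[h --> (0 : 'rV[R]_n)] --> (0 : 'rV[R]_n) by exact: cvg_id.
have cx (z : 'rV[R]_n) : z @[h --> (0 : 'rV[R]_n)] --> z.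
  exact: (@cvg_cst 'rV[R]_n z _ (nbhs (0 : 'rV[R]_n)) _).
have c1 : Y h - h @[h --> (0 : 'rV[R]_n)] --> y.
  by rewrite -[y in _ --> y]subr0; exact: (cvgB Yy idc).
have c2 : dmap p (x - Y h) @[h --> (0 : 'rV[R]_n)] --> dmap p (x - y).
  apply: (cvg_comp (fun h => x - Y h) (dmap p) (G := nbhs (x - y))).
    exact: (cvgB (cx x) Yy).
  exact: (dmap_continuous p1).
have c3 : dmap p (x + h - Y h) @[h --> (0 : 'rV[R]_n)] --> dmap p (x - y).
  apply: (cvg_comp (fun h => x + h - Y h) (dmap p) (G := nbhs (x - y))).
    by rewrite -[x in x - y]addr0; exact: (cvgB (cvgD (cx x) idc) Yy).
  exact: (dmap_continuous p1).
move: c1 c2 c3 => /cvg_enormP c1 /cvg_enormP c2 /cvg_enormP c3.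
near=> h.
have k1 : enorm (Y h - h - y) < 1 by near: h; exact: c1.
have k1' : enorm (Y h - h - y) < e' by near: h; exact: c1.
have k2 : enorm (dmap p (x - Y h) - dmap p (x - y)) < e' by near: h; exact: c2.
have k3 : enorm (dmap p (x + h - Y h) - dmap p (x - y)) < e'.
  by near: h; exact: c3.
have k4 : `|f (x + h) - f x - dotp (grad f x) h| <= e' * enorm h.
  by near: h; exact: near_grad.
have k5 : enorm (grad f (x + h) - grad f x - h *m hess f x) <= e' * enorm h.
  by near: h; exact: near_jacobian.
have h0 := enorm_ge0 h.
set a := f (x + h) - f x - _ in k4.
set b := grad f (x + h) - grad f x - _ in k5.
set w := Y h - h - y in k1 k1'.
set P := (p * gamma)^-1 * enorm (x + h - Y h) `^ p
  - (p * gamma)^-1 * enorm (x - Y h) `^ p - gamma^-1 * dotp (dmap p (x - y)) h.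
(* [a], [b] and [P] are the remainders of [f], [grad f] and the prox term, and [w] measures the gap
   between [Y h - h] and [y]. Symmetry of the Hessian moves it from [y - x] onto [h]. *)
have -> : smooth_model (x + h) (Y h) - smooth_model x (Y h)
      - dotp (smooth_model_grad x y) h
    = a + dotp b (y - x + w) + dotp (h *m hess f x) w + P.
  have yw : y - x + w = Y h - (x + h).
    by rewrite /w addrC addrA subrK opprD addrCA addrC.
  rewrite yw.
  rewrite /smooth_model /smooth_model_grad dotpDl dotpZl hess_sym//.
  have -> : Y h - x = Y h - (x + h) + h by rewrite opprD addrA subrK.
  have -> : dotp (h *m hess f x) (y - x) =
      dotp (h *m hess f x) (Y h - (x + h)) - dotp (h *m hess f x) w.
    by rewrite -yw (dotpDr _ _ w) addrK.
  exact: expansion_split.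
have kb : `|dotp b (y - x + w)| <= e' * enorm h * (enorm (y - x) + 1).
  rewrite (le_trans (normr_dotp_le _ _))// ler_pM ?enorm_ge0//.
  by rewrite (le_trans (enormD_le _ _))// lerD2l ltW.
have kh : `|dotp (h *m hess f x) w| <= MH * enorm h * e'.
  rewrite (le_trans (normr_dotp_le _ _))// ler_pM ?enorm_ge0//.
    exact: enorm_mulmx_le.
  exact: ltW.
have kP : `|P| <= gamma^-1 * (e' * enorm h).
  (* The two subgradients bound the increment from below and from above; both tend to
     [dmap p (x - y)]. *)
  have u1 := prox_term_convex (x - Y h) (x + h - Y h).
  have u2 := prox_term_convex (x + h - Y h) (x - Y h).
  have d1 : x + h - Y h - (x - Y h) = h.
    by rewrite opprB addrA subrK addrAC subrr add0r.
  rewrite d1 in u1; rewrite -[x - Y h - _]opprB d1 dotpNr in u2.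
  have v1 : `|dotp (dmap p (x - Y h) - dmap p (x - y)) h| <= e' * enorm h.
    by rewrite (le_trans (normr_dotp_le _ _))// ler_wpM2r// ltW.
  have v2 : `|dotp (dmap p (x + h - Y h) - dmap p (x - y)) h| <= e' * enorm h.
    by rewrite (le_trans (normr_dotp_le _ _))// ler_wpM2r// ltW.
  rewrite dotpBl ler_norml in v1; rewrite dotpBl ler_norml in v2.
  move: v1 v2 => /andP[v1 _] /andP[_ v2].
  have := ler_wpM2l (ltW gi0) v1; have := ler_wpM2l (ltW gi0) v2.
  rewrite !mulrBr mulrN => v3 v4; rewrite mulrN in u2.
  exact: norm_sandwich u1 u2 v4 v3.
have -> : e * enorm h = e' * enorm h + e' * enorm h * (enorm (y - x) + 1)
    + MH * enorm h * e' + gamma^-1 * (e' * enorm h).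
  have -> : e = e' * B by rewrite /e' divfK// gt_eqF.
  by rewrite /B; ring.
do 3 (rewrite (le_trans (ler_normD _ _))// lerD//).
Unshelve. all: by end_near. Qed.

Lemma smooth_model_grad_cvg {T : Type} (F : set_system T) {FF : Filter F}
    (X Y : T -> 'rV[R]_n) x y : X @ F --> x -> Y @ F --> y ->
    hess f (X t) @[t --> F] --> hess f x ->
  smooth_model_grad (X t) (Y t) @[t --> F] --> smooth_model_grad x y.
Proof.
move=> Xx Yy Hx; apply: cvgD.
  by apply: cvg_mulmx => //; exact: cvgB.
apply: cvgZr; apply: (cvg_comp (fun t => X t - Y t) (dmap p) (G := nbhs (x - y))).
  exact: cvgB.
exact: (dmap_continuous p1).
Qed.

Lemma smooth_model_cvg {T : Type} (F : set_system T) {FF : Filter F}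
    (Y : T -> 'rV[R]_n) x y : Y @ F --> y ->
  smooth_model x (Y t) @[t --> F] --> smooth_model x y.
Proof.
(* Written as [dotp (dmap p u) u], the prox term inherits continuity from [dmap]. *)
move=> Yy; rewrite /smooth_model -(dotp_dmap p1).
under eq_fun do rewrite -(dotp_dmap p1).
have cx : x @[_ --> F] --> x by exact: cvg_cst.
have xY : (x - Y t) @[t --> F] --> x - y by exact: cvgB.
apply: cvgD.
  apply: cvgD; first exact: cvg_cst.
  by apply: cvg_dotp; [exact: cvg_cst|exact: cvgB].
apply: cvgMr; apply: cvg_dotp => //.
apply: (cvg_comp (fun t => x - Y t) (dmap p) (G := nbhs (x - y))) => //.
exact: (dmap_continuous p1).
Qed.

Lemma smooth_model_continuous x : continuous (smooth_model x).
Proof.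
by move=> y; exact: (@smooth_model_cvg _ (nbhs (y : 'rV[R]_n)) _ id x y cvg_id).
Qed.

End Model.

(** * Envelope and splitting *)

(** [a1] and [a0] stand for envelope values, [c] for a value of [g], and [s1] and [s0] for values of
    the smooth model. *)
Fact sub_le_of_touch {R : realType} (a1 a0 c s1 s0 d e : R) :
  a1 <= c + s1 -> a0 = c + s0 -> `|s1 - s0 - d| <= e -> a1 - a0 - d <= e.
Proof. by move=> ? -> /ler_normlW; lra. Qed.

Fact sub_ge_of_touch {R : realType} (a1 a0 c s1 s0 d e : R) :
  a0 <= c + s0 -> a1 = c + s1 -> `|s1 - s0 - d| <= e -> - e <= a1 - a0 - d.
Proof. by move=> ? -> ; rewrite ler_norml => /andP[? _]; lra. Qed.

(** After multiplication by [p * gamma], the minorant of [g] contributes [gamma / gamma_g * Q]. The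
    factor 1/8 against the 4 in the bound on [Q] makes this at most [(B + S) / 2], so half of [S] is
    absorbed on the left. *)
Fact sublevel_arith {R : realType}
    (p gamma gamma_g G s c m S Q B W V fx gy gz d1 d2 : R) :
  0 < p -> 0 < gamma <= gamma_g / 8 ->
  0 <= G -> 0 <= s -> 0 <= c -> 0 <= S -> 0 <= B ->
  m - (p * gamma_g)^-1 * Q <= gy -> Q <= 4 * (B + S) ->
  gy + (fx + d1 + (p * gamma)^-1 * S) <= gz + (fx + d2 + (p * gamma)^-1 * V) ->
  V <= W -> - (G * s) <= d1 -> d2 <= G * c ->
  S <= 2 * (p * gamma_g) * G * s
       + (2 * (p * gamma_g) * (`|m| + G * c + `|gz|) + B + 2 * W).
Proof.
move=> p0 /andP[g0 gle] G0 s0 c0 S0 B0 hm hQ hle VW hd1 hd2.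
pose k := p * gamma; pose K := p * gamma_g; pose a := k * K^-1.
have k0 : 0 < k by rewrite mulr_gt0.
have gg0 : 0 < gamma_g by lra.
have K0 : 0 < K by rewrite mulr_gt0.
have a0 : 0 <= a by rewrite divr_ge0 ?ltW.
have kK : k <= K / 8 by have := ler_wpM2l (ltW p0) gle; rewrite mulrA.
have a1 : a <= 1 / 8 by rewrite /a ler_pdivrMr// mulrC mulrA mulr1.
have aQ : a * Q <= (B + S) / 2.
  apply: (@le_trans _ _ (a * (4 * (B + S)))); first by rewrite ler_wpM2l.
  have : a * (4 * (B + S)) <= 1 / 8 * (4 * (B + S)).
    by rewrite ler_wpM2r// mulr_ge0// addr_ge0.
  lra.
have h1 := ler_wpM2l (ltW k0) hm.
have h2 := ler_wpM2l (ltW k0) hle.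
rewrite -/K mulrBr mulrA -/a in h1.
have kV v : k * ((p * gamma)^-1 * v) = v by rewrite mulVKf// gt_eqF.
rewrite !mulrDr !kV in h2.
have mE : - `|m| <= m by rewrite lerNl -normrN ler_norm.
have gE : gz <= `|gz| := ler_norm _.
have k1 : k * gz <= K * `|gz|.
  apply: (@le_trans _ _ (k * `|gz|)); first by rewrite ler_pM2l.
  by rewrite ler_wpM2r//; lra.
have k2 : k * d2 <= K * (G * c).
  apply: (@le_trans _ _ (k * (G * c))); first by rewrite ler_pM2l.
  by rewrite ler_wpM2r ?mulr_ge0//; lra.
have k3 : - (K * (G * s)) <= k * d1.
  rewrite lerNl -mulrN; apply: (@le_trans _ _ (k * (G * s))).
    by rewrite ler_pM2l// lerNl.
  by rewrite ler_wpM2r ?mulr_ge0//; lra.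
have k4 : - (K * `|m|) <= k * m.
  rewrite lerNl -mulrN; apply: (@le_trans _ _ (k * `|m|)).
    by rewrite ler_pM2l// lerNl.
  by rewrite ler_wpM2r//; lra.
rewrite -/K; lra.
Qed.

Section Envelope.
Context {R : realType} {n : nat} (f : 'rV[R]_n -> R) (g : 'rV[R]_n -> \bar R).
Context (p gamma : R) (p1 : 1 < p) (gamma0 : 0 < gamma).
Context (fdiff : forall x, differentiable f x).
Context (gNy : avoids_ninfty g) (gproper : proper_fun g).
Implicit Types (x y z h : 'rV[R]_n).

Local Notation phi := (fb_envelope f g p gamma).
Local Notation T := (fb_splitting f g p gamma).
Local Notation sigma := (smooth_model f p gamma).

Lemma fb_envelope_le x y : (phi x <= g y + (sigma x y)%:E)%E.
Proof. by rewrite -fb_modelE; apply: ereal_inf_lbound; exists y. Qed.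

Lemma fb_envelope_attained x y : T x y -> phi x = (g y + (sigma x y)%:E)%E.
Proof.
move=> Txy; apply/le_anti; rewrite fb_envelope_le/= -fb_modelE.
by apply/ereal_infP => _ [z _ <-]; exact: Txy.
Qed.

Lemma fb_splitting_fin x y : T x y -> g y \is a fin_num.
Proof.
have [z gz] := gproper; move=> /(_ z); rewrite !fb_modelE -(fineK gz) -EFinD.
by case: (g y) (gNy y).
Qed.

Lemma fine_fb_envelope x y : T x y -> fine (phi x) = fine (g y) + sigma x y.
Proof.
move=> Txy; rewrite (fb_envelope_attained Txy).
by rewrite -(fineK (fb_splitting_fin Txy)).
Qed.

Lemma fine_fb_envelope_le x y : phi x \is a fin_num -> g y \is a fin_num ->
  fine (phi x) <= fine (g y) + sigma x y.
Proof.
by move=> px gy; have := fb_envelope_le x y; rewrite -(fineK px) -(fineK gy).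
Qed.

Lemma fb_envelope_fin x y : T x y -> phi x \is a fin_num.
Proof.
move=> Txy; rewrite (fb_envelope_attained Txy).
by rewrite -(fineK (fb_splitting_fin Txy)).
Qed.

(* At [x] the smooth function [fine (g y) + smooth_model f p gamma ^~ y]
   touches the envelope from above, so both have the same gradient. *)
Lemma grad_fb_envelope (A : set 'rV[R]_n) x y : open A -> A x ->
  differentiable (grad f) x -> C1e_on A phi -> T x y ->
  grad (fun x => fine (phi x)) x = smooth_model_grad f p gamma x y.
Proof.
move=> oA Ax ddf [Afin [Adiff _]] Txy; apply: grad_upper; first exact: Adiff.
move=> e e0.
have cy : y @[_ --> (0 : 'rV[R]_n)] --> y.
  exact: (@cvg_cst 'rV[R]_n y _ (nbhs (0 : 'rV[R]_n)) _).
have nA : \forall h \near (0 : 'rV[R]_n), A (x + h).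
  by apply: near_shift0; exact: (open_nbhs_nbhs (conj oA Ax)).
have := smooth_model_expansion p1 gamma0 fdiff ddf cy e0.
apply: filterS2 nA => h Axh.
apply: sub_le_of_touch (fine_fb_envelope Txy).
by apply: fine_fb_envelope_le; [exact: Afin|exact: fb_splitting_fin Txy].
Qed.

(** The upper estimate keeps the minimizer [t x] fixed; the lower one uses [t (x + h)] as a
    competitor at [x]. Continuity of [t] gives both expansions the same linear part. *)
Lemma fb_envelope_differentiable (A : set 'rV[R]_n) (t : 'rV[R]_n -> 'rV[R]_n) x :
  open A -> A x -> differentiable (grad f) x -> (forall z, A z -> T z (t z)) ->
  t z @[z --> x] --> t x ->
  differentiable (fun x => fine (phi x)) x /\
  grad (fun x => fine (phi x)) x = smooth_model_grad f p gamma x (t x).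
Proof.
move=> oA Ax ddf At tx; apply: grad_unique => e e0.
have cy : t x @[_ --> (0 : 'rV[R]_n)] --> t x.
  exact: (@cvg_cst 'rV[R]_n (t x) _ (nbhs (0 : 'rV[R]_n)) _).
have ct : t (x + h) @[h --> (0 : 'rV[R]_n)] --> t x.
  apply/(@cvg_enormP _ _ _ (nbhs (0 : 'rV[R]_n))) => d d0.
  by apply: (@near_shift0 _ _ x (fun z => enorm (t z - t x) < d));
    move: d d0; apply/(@cvg_enormP _ _ _ (nbhs x)).
have nA : \forall h \near (0 : 'rV[R]_n), A (x + h).
  by apply: near_shift0; exact: (open_nbhs_nbhs (conj oA Ax)).
have up := smooth_model_expansion p1 gamma0 fdiff ddf cy e0.
have lo := smooth_model_expansion p1 gamma0 fdiff ddf ct e0.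
apply: filterS3 nA up lo => h Axh up lo; rewrite ler_norml; apply/andP; split.
  apply: sub_ge_of_touch (fine_fb_envelope (At _ Axh)) lo.
  apply: fine_fb_envelope_le; first exact: fb_envelope_fin (At _ Ax).
  exact: fb_splitting_fin (At _ Axh).
apply: sub_le_of_touch (fine_fb_envelope (At _ Ax)) up.
apply: fine_fb_envelope_le; first exact: fb_envelope_fin (At _ Axh).
exact: fb_splitting_fin (At _ Ax).
Qed.

End Envelope.

(** * Uniform boundedness of the sublevel sets of the model *)

Section SplittingMap.
Context {R : realType} {n : nat} (f : 'rV[R]_n -> R) (g : 'rV[R]_n -> \bar R).
Context (p r : R) (p1 : 1 < p) (p2 : p <= 2) (r0 : 0 < r).
Context (gNy : avoids_ninfty g).
Implicit Types (x y z h : 'rV[R]_n).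

Lemma prox_bounded_minorant (gamma : R) : prox_bounded_at p g gamma ->
  exists x (m : R),
    forall y, ((m - (p * gamma)^-1 * enorm (x - y) `^ p)%:E <= g y)%E.
Proof.
move=> [_ [x]]; set i := ereal_inf _ => iNy.
have [m mi] : exists m : R, (m%:E <= i)%E.
  by case: i iNy => [s| |]// _; [exists s|exists 0; exact: leey].
exists x, m => y.
have : (m%:E <= g y + ((p * gamma)^-1 * enorm (x - y) `^ p)%:E)%E.
  by apply: (le_trans mi); apply: ereal_inf_lbound; exists y.
case: (g y) (gNy y) => [s| |]// _; first by rewrite -EFinD !lee_fin lerBlDr.
by move=> _; exact: leey.
Qed.

(** Comparison with [z0] and the prox minorant of [g] bound the power [p] of the displacement by an
    affine function of it. The coefficients depend on neither [gamma] nor [x], so one [C] serves for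
    all of them. *)
Lemma fb_model_sublevel_bounded (gamma_g G : R) (z0 : 'rV[R]_n) :
  prox_bounded_at p g gamma_g -> g z0 \is a fin_num ->
  (forall x, eball 0 r x -> enorm (grad f x) <= G) ->
  exists2 C : R, 0 < C & forall (gamma : R) x y, 0 < gamma <= gamma_g / 8 ->
    eball 0 r x ->
    (fb_model f g p gamma x y <= fb_model f g p gamma x z0)%E ->
    enorm (x - y) <= C.
Proof.
move=> gprox gz0 fG; have [gg0 _] := gprox.
have [x0 [m hm]] := prox_bounded_minorant gprox.
have p0 : 0 < p := lt_trans ltr01 p1.
(* For [x] in the ball, [b] and [c] bound its distances to [x0] and [z0]. *)
pose b := enorm x0 + r; pose c := enorm z0 + r; pose K := p * gamma_g.
have b0 : 0 <= b by rewrite addr_ge0 ?enorm_ge0// ltW.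
have c0 : 0 <= c by rewrite addr_ge0 ?enorm_ge0// ltW.
have G0 : 0 <= G.
  by rewrite (le_trans (enorm_ge0 (grad f 0)))// fG// /eball/= subrr enorm0.
have K0 : 0 < K by rewrite mulr_gt0.
pose E : R := `|m| + G * c + `|fine (g z0)|.
have E0 : 0 <= E by rewrite !addr_ge0 ?mulr_ge0.
pose A := 2 * K * E + b `^ p + 2 * c `^ p.
have A0 : 0 <= A by rewrite !addr_ge0 ?mulr_ge0 ?powR_ge0// ltW.
exists (1 + (A + 2 * K * G) `^ (p - 1)^-1).
  by rewrite ltr_pwDl// powR_ge0.
move=> gamma x y gamma_le xr model_le.
apply: powR_affine_bound => //; first exact: enorm_ge0.
have xr' : enorm x <= r by move: xr; rewrite /eball/= subr0 => /ltW.
set s := enorm (x - y).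
have s0 : 0 <= s := enorm_ge0 _.
have gy : g y \is a fin_num.
  move: model_le; rewrite !fb_modelE -(fineK gz0) -EFinD.
  by case: (g y) (gNy y).
have := hm y; rewrite -(fineK gy) lee_fin => hmy.
move: model_le; rewrite !fb_modelE -(fineK gz0) -(fineK gy) -!EFinD lee_fin.
rewrite /smooth_model -/s => model_le.
have xz : enorm (x - z0) <= c.
  by rewrite (le_trans (enormD_le _ _))// enormN addrC lerD2l.
have cp : enorm (x - z0) `^ p <= c `^ p.
  by rewrite ge0_ler_powR// ?nnegrE ?enorm_ge0// ltW.
have xy : enorm (x0 - y) <= b + s.
  have -> : x0 - y = x0 - x + (x - y) by rewrite addrA subrK.
  rewrite (le_trans (enormD_le _ _))// lerD2r (le_trans (enormD_le _ _))//.
  by rewrite enormN lerD2l.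
have bp : enorm (x0 - y) `^ p <= 4 * (b `^ p + s `^ p).
  apply: (@le_trans _ _ ((b + s) `^ p)).
    have bs0 : 0 <= b + s by exact: addr_ge0.
    by rewrite ge0_ler_powR ?nnegrE ?enorm_ge0// ltW.
  by apply: powRD_le => //; rewrite (ltW p0).
have d1 : - (G * s) <= dotp (grad f x) (y - x).
  have := normr_dotp_le (grad f x) (y - x); rewrite ler_norml => /andP[+ _].
  by apply: le_trans; rewrite lerN2 enormC ler_wpM2r// fG.
have d2 : dotp (grad f x) (z0 - x) <= G * c.
  rewrite (le_trans (dotp_le _ _))// ler_pM ?enorm_ge0//; first exact: fG.
  by rewrite enormC.
exact: (sublevel_arith p0 gamma_le G0 s0 c0 (powR_ge0 s p) (powR_ge0 b p) hmy bp
  model_le cp d1 d2).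
Qed.

End SplittingMap.

(** * The displacement estimate and the theorem *)

Fact sub_sub_displacement (V : zmodType) (a b x z : V) :
  a - b = z - x - (z - a - (x - b)).
Proof. by rewrite opprB (opprB z a) addrA subrKA addrC subrKA. Qed.

(** The term [K * gamma * M * a] is at most [a / 2] and is absorbed on the left, whence the factor
    2. *)
Fact displacement_arith {R : realType} (K gamma M a d s m l k q : R) :
  0 < K * gamma -> 0 <= a -> 2 * (K * gamma * M) <= 1 -> a <= K * (gamma * s) ->
  s <= d + m -> m <= l + k -> l <= M * a -> k <= q ->
  a <= 2 * K * gamma * (d + q).
Proof.
move=> Kg0 a0 small h h1 h2 h3 h4.
have b1 : s <= d + M * a + q by lra.
have := ler_wpM2l (ltW Kg0) b1; have := ler_wpM2r a0 small; nra.
Qed.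

Section Displacement.
Context {R : realType} {n : nat}.
Implicit Types (u v D : 'rV[R]_n).

(* [D] plays the role of the gradient of the envelope: it determines
   [dmap p u] up to a term that is Lipschitz in [u] with constant [gamma * M],
   hence [u] itself when [gamma] is small. *)
Lemma displacement_le (p gamma K M C : R) u1 u2 D1 D2 (H1 H2 : 'M[R]_n) :
  0 < gamma -> 0 < K -> 0 <= C -> 2 * (K * gamma * M) <= 1 ->
  enorm (u1 - u2) <= K * enorm (dmap p u1 - dmap p u2) ->
  (forall v, enorm (v *m H1) <= M * enorm v) -> enorm u2 <= C ->
  D1 = (- u1) *m H1 + gamma^-1 *: dmap p u1 ->
  D2 = (- u2) *m H2 + gamma^-1 *: dmap p u2 ->
  enorm (u1 - u2) <=
    2 * K * gamma * (enorm (D1 - D2) + n%:R * n%:R * `|H1 - H2| * C).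
Proof.
move=> g0 K0 C0 small hK hM u2C D1E D2E.
have J1 : dmap p u1 = gamma *: (D1 + u1 *m H1).
  by rewrite D1E mulNmx addrAC addNr add0r scalerA divff ?scale1r ?gt_eqF.
have J2 : dmap p u2 = gamma *: (D2 + u2 *m H2).
  by rewrite D2E mulNmx addrAC addNr add0r scalerA divff ?scale1r ?gt_eqF.
have JE : dmap p u1 - dmap p u2
    = gamma *: (D1 - D2 + ((u1 - u2) *m H1 + u2 *m (H1 - H2))).
  rewrite J1 J2 -scalerBr; congr (_ *: _).
  rewrite opprD addrACA mulmxBl mulmxBr; congr (_ + _).
  by rewrite addrA subrK.
rewrite JE enormZ gtr0_norm// in hK.
have h1 := enormD_le (D1 - D2) ((u1 - u2) *m H1 + u2 *m (H1 - H2)).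
have h2 := enormD_le ((u1 - u2) *m H1) (u2 *m (H1 - H2)).
have h3 := hM (u1 - u2).
have h4 : enorm (u2 *m (H1 - H2)) <= n%:R * n%:R * `|H1 - H2| * C.
  by rewrite (le_trans (enorm_mulmx_le _ _))// ler_wpM2l// !mulr_ge0.
exact: displacement_arith (mulr_gt0 K0 g0) (enorm_ge0 _) small hK h1 h2 h3 h4.
Qed.

End Displacement.

(** * Hessian bound on the ball and existence of minimizers *)

Section Ball.
Context {R : realType} {n : nat}.

Lemma hess_bound (f : 'rV[R]_n -> R) (U : set 'rV[R]_n) (r : R) :
  0 < r -> open U -> closure (eball 0 r) `<=` U ->
  {within U, continuous (hess f)} ->
  exists2 M, 0 <= M & forall x v, eball 0 r x ->
    enorm (v *m hess f x) <= M * enorm v.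
Proof.
move=> r0 oU BU; rewrite continuous_open_subspace// => ch.
have cN : {within closure (eball (0 : 'rV[R]_n) r),
    continuous (fun x => `|hess f x| : R)}.
  apply: continuous_in_subspaceT => x /set_mem /BU/mem_set/ch hx.
  exact: (cvg_norm hx).
have B0 : closure (eball (0 : 'rV[R]_n) r) !=set0.
  exists 0; apply: subset_closure; by rewrite /eball/= subrr enorm0.
have [c _ cmax] := EVT_max_rV B0 (@compact_closure_eball R n 0 r) cN.
exists (n%:R * n%:R * `|hess f c|); first by rewrite !mulr_ge0.
move=> x v xr; apply: (le_trans (enorm_mulmx_le v (hess f x))).
apply: ler_wpM2r; first exact: enorm_ge0.
apply: ler_wpM2l; first exact: mulr_ge0.
by apply: cmax; apply/mem_set; exact: subset_closure.
Qed.

(** The model attains its minimum on a compact ball containing [z0]; outside that ball its values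
    exceed the value at [z0]. *)
Lemma fb_splitting_nonempty (f : 'rV[R]_n -> R) (g : 'rV[R]_n -> \bar R)
    (p gamma C : R) x z0 : 1 < p ->
  avoids_ninfty g -> lower_semicontinuous g ->
  (forall y, (fb_model f g p gamma x y <= fb_model f g p gamma x z0)%E ->
    enorm (x - y) <= C) ->
  exists y, fb_splitting f g p gamma x y.
Proof.
move=> p1 gNy glsc hC.
have ball_sub y : enorm (x - y) <= C -> closure (eball x (C + 1)) y.
  move=> yC; apply: subset_closure; rewrite /eball/= enormC.
  by rewrite (le_lt_trans yC)// ltrDl.
have z0K : closure (eball x (C + 1)) z0 by apply: ball_sub; exact: hC.
have lsc : lower_semicontinuous (fb_model f g p gamma x).
  rewrite (_ : fb_model f g p gamma x
    = fun y => g y + (smooth_model f p gamma x y)%:E)%E; last first.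
    by apply/funext => y; exact: fb_modelE.
  by apply: lower_semicontinuous_addr => //; exact: smooth_model_continuous.
have mNy y : fb_model f g p gamma x y != -oo%E.
  by rewrite fb_modelE; case: (g y) (gNy y).
have [y yK ymin] := lower_semicontinuous_compact_min
  (@compact_closure_eball R n x (C + 1)) (ex_intro _ _ z0K) lsc mNy.
exists y => z.
have [zK|zK] := pselect (closure (eball x (C + 1)) z); first exact: ymin.
apply: (le_trans (ymin _ z0K)); apply: ltW; rewrite ltNge.
by apply/negP => /hC/ball_sub.
Qed.

End Ball.

(** * The two implications between smoothness of the envelope and continuity of the splitting *)

Section Theorem28.
Context (R : realType) (n : nat) (nu p L r : R).
Context (f : 'rV[R]_n -> R) (g : 'rV[R]_n -> \bar R) (U : set 'rV[R]_n).
Context (hnu : 0 < nu <= 1) (hp : p = 1 + nu) (hL : 0 <= L).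
Context (hfdiff : forall x, differentiable f x) (hfholder : holder_gradient nu L f).
Context (hgninfty : avoids_ninfty g) (hgproper : proper_fun g).
Context (hglsc : lower_semicontinuous g) (hgprox : prox_bounded p g).
Context (hr : 0 < r) (hUopen : open U) (hUball : closure (eball 0 r) `<=` U).
Context (hfC2 : C2_on U f).

Let p1 : 1 < p. Proof. by rewrite hp ltrDl; case/andP: hnu. Qed.
Let p2 : p <= 2.
Proof. by rewrite hp; case/andP: hnu => _; lra. Qed.

Let ballU x : eball 0 r x -> U x.
Proof. by move=> xr; apply: hUball; exact: subset_closure. Qed.

Let ddf x : eball 0 r x -> differentiable (grad f) x.
Proof. by case: hfC2 => _ h _ /ballU; exact: h. Qed.

Let chess x : eball 0 r x -> hess f z @[z --> x] --> hess f x.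
Proof.
case: hfC2 => _ _; rewrite continuous_open_subspace// => h /ballU/mem_set.
exact: h.
Qed.

Lemma grad_ball_bound x : eball 0 r x ->
  enorm (grad f x) <= enorm (grad f 0) + L * r `^ nu.
Proof.
move=> xr; rewrite -[grad f x](subrK (grad f 0)) addrC.
rewrite (le_trans (enormD_le _ _))// lerD2l (le_trans (hfholder 0 x))//.
rewrite ler_wpM2l// ge0_ler_powR ?nnegrE ?enorm_ge0//.
- by case/andP: hnu => /ltW.
- exact: ltW.
- exact: ltW.
Qed.

Lemma splitting_of_C1_envelope : exists gamma_bar : R,
  [/\ 0 < gamma_bar, (gamma_bar%:E < prox_threshold p g)%E &
     forall gamma : R, 0 < gamma < gamma_bar ->
       C1e_on (eball 0 r) (fb_envelope f g p gamma) ->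
       single_valued_continuous_on (eball 0 r) (fb_splitting f g p gamma)].
Proof.
have [z0 gz0] := hgproper; have [gamma_g gprox] := hgprox.
have gg0 := gprox.1.
have [C C0 hC] := fb_model_sublevel_bounded p1 p2 hr hgninfty gprox gz0
  grad_ball_bound.
have [K K0 hK] := @dmap_inverse_lipschitz R n p p1 C p2 C0.
have [|M M0 hM] := @hess_bound _ _ f U r hr hUopen hUball.
  by case: hfC2.
(* The first bound makes [C] available and lies strictly below the threshold; the second gives the
   smallness condition of [displacement_le]. *)
pose gamma_bar := Num.min (gamma_g / 8) (2 * K * (M + 1))^-1.
have KM0 : 0 < 2 * K * (M + 1) by rewrite !mulr_gt0// ltr_wpDl.
exists gamma_bar; split.
- by rewrite lt_min divr_gt0//= invr_gt0.
- apply: (@lt_le_trans _ _ gamma_g%:E).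
    by rewrite lte_fin (@le_lt_trans _ _ (gamma_g / 8)) ?ge_min ?lexx//; lra.
  by apply: ereal_sup_ubound; exists gamma_g.
move=> gamma /andP[g0]; rewrite lt_min => /andP[g8 gKM] hC1.
have g8' : 0 < gamma <= gamma_g / 8 by rewrite g0 ltW.
have small : 2 * (K * gamma * M) <= 1.
  have : gamma * (2 * K * (M + 1)) <= 1 by rewrite -ler_pdivlMr// div1r ltW.
  by have := mulr_gt0 K0 g0; nra.
have splitC x y : eball 0 r x -> fb_splitting f g p gamma x y -> enorm (x - y) <= C.
  by move=> xr Txy; apply: (hC gamma) => //; exact: Txy.
have ex x : eball 0 r x -> exists y, fb_splitting f g p gamma x y.
  move=> xr; apply: (@fb_splitting_nonempty _ _ f g p gamma C x z0) => // y.
  exact: hC.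
have [_ [_ cgrad]] := hC1; have oB := @open_eball R n 0 r.
rewrite continuous_open_subspace// in cgrad.
pose grad_phi := grad (fun x => fine (fb_envelope f g p gamma x)).
(* Stated for arbitrary minimizers, so that equal base points give uniqueness and nearby ones give
   continuity. *)
have est x1 x2 y1 y2 : eball 0 r x1 -> eball 0 r x2 ->
    fb_splitting f g p gamma x1 y1 -> fb_splitting f g p gamma x2 y2 ->
    enorm ((x1 - y1) - (x2 - y2)) <= 2 * K * gamma *
      (enorm (grad_phi x1 - grad_phi x2)
       + n%:R * n%:R * `|hess f x1 - hess f x2| * C).
  move=> x1r x2r T1 T2.
  have E1 := grad_fb_envelope p1 g0 hfdiff hgninfty hgproper oB x1r (ddf x1r) hC1 T1.
  have E2 := grad_fb_envelope p1 g0 hfdiff hgninfty hgproper oB x2r (ddf x2r) hC1 T2.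
  apply: (displacement_le g0 K0 (ltW C0) small).
  - by apply: hK; exact: splitC.
  - by move=> v; exact: hM.
  - exact: splitC.
  - by rewrite opprB; exact: E1.
  - by rewrite opprB; exact: E2.
(* The default value 0 can only occur outside the ball, since minimizers exist at each of its
   points. *)
pose t x := xget 0 (fb_splitting f g p gamma x).
have Tt x : eball 0 r x -> fb_splitting f g p gamma x (t x).
  by move=> /ex[y Ty]; exact: (xgetPex 0 (ex_intro _ y Ty)).
exists t; split=> [x xr|].
  apply/seteqP; split=> [y Ty|_ ->]; last exact: Tt.
  have := est _ _ _ _ xr xr Ty (Tt x xr).
  rewrite !subrr enorm0 normr0 mulr0 mul0r addr0 mulr0 => u0.
  have /enorm_eq0/eqP : enorm (x - y - (x - t x)) = 0.
    by apply: le_anti; rewrite u0 enorm_ge0.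
  by rewrite subr_eq0 => /eqP/addrI/oppr_inj.
rewrite continuous_open_subspace// => x /set_mem xr.
apply/(@cvg_enormP _ _ _ (nbhs (x : 'rV[R]_n))) => e e0.
(* [B] exceeds by 1 the total coefficient of [e / B] in the final estimate, which makes that
   estimate strict. *)
pose B := 2 * K * gamma * (1 + n%:R * n%:R * C) + 2.
have B0 : 0 < B.
  by rewrite ltr_wpDl// !mulr_ge0 ?addr_ge0 ?mulr_ge0// ltW.
have d0 : 0 < e / B by rewrite divr_gt0.
have n1 : \forall z \near x, eball 0 r z by exact: (open_nbhs_nbhs (conj oB xr)).
have n2 : \forall z \near x, enorm (grad_phi z - grad_phi x) < e / B.
  have /(@cvg_enormP _ _ _ (nbhs (x : 'rV[R]_n))) := cgrad _ (mem_set xr).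
  exact.
have n3 : \forall z \near x, `|hess f x - hess f z| < e / B.
  by have /cvgrPdist_lt := chess xr; exact.
have n4 : \forall z \near x, enorm (z - x) < e / B.
  by apply/nbhs_enormP; exists (e / B).
near=> z.
have zr : eball 0 r z by near: z.
have k2 : enorm (grad_phi z - grad_phi x) < e / B by near: z.
have k3 : `|hess f x - hess f z| < e / B by near: z.
have k4 : enorm (z - x) < e / B by near: z.
(* The estimate controls displacements [x - t x], so the change of the base point is split off. *)
have tzx : t z - t x = (z - x) - ((z - t z) - (x - t x)).
  exact: sub_sub_displacement.
have := est _ _ _ _ zr xr (Tt z zr) (Tt x xr).
rewrite tzx distrC => k5.
rewrite (le_lt_trans (enormD_le _ _))// enormN.
pose q := e / B; have eE : e = q * B by rewrite /q divfK// gt_eqF.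
have Kg0 : 0 <= 2 * K * gamma by rewrite ltW// !mulr_gt0.
apply: (@le_lt_trans _ _ (q + 2 * K * gamma * (q + n%:R * n%:R * q * C))).
  apply: lerD; first exact: ltW.
  apply: (le_trans k5); apply: ler_wpM2l => //.
  apply: lerD; first exact: ltW.
  by apply: ler_wpM2r (ltW C0) _ _ _; apply: ler_wpM2l (ltW k3); exact: mulr_ge0.
by rewrite [ltRHS]eE /B; have : 0 < q := d0; lra.
Unshelve. all: by end_near. Qed.

Lemma C1_envelope_of_splitting (gamma : R) : 0 < gamma ->
  single_valued_continuous_on (eball 0 r) (fb_splitting f g p gamma) ->
  C1e_on (eball 0 r) (fb_envelope f g p gamma) /\
  forall xb yb : 'rV[R]_n, eball 0 r xb ->
    fb_splitting f g p gamma xb = [set yb] ->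
    grad (fun x => fine (fb_envelope f g p gamma x)) xb =
      smooth_model_grad f p gamma xb yb.
Proof.
move=> g0 [t [Tt ct]]; have oB := @open_eball R n 0 r.
rewrite continuous_open_subspace// in ct.
have At x : eball 0 r x -> fb_splitting f g p gamma x (t x).
  by move=> /Tt->.
have diffE x (xr : eball 0 r x) := fb_envelope_differentiable p1 g0 hfdiff
  hgninfty hgproper oB xr (ddf xr) At (ct _ (mem_set xr)).
split; last first.
  move=> x y xr; rewrite Tt// => /seteqP[/(_ (t x) erefl) /= <- _].
  exact: (diffE x xr).2.
split; first by move=> x /At; exact: fb_envelope_fin.
split; first by move=> x xr; exact: (diffE x xr).1.
rewrite continuous_open_subspace// => x /set_mem xr.
rewrite /continuous_at (diffE x xr).2.
have sm : smooth_model_grad f p gamma z (t z) @[z --> x]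
    --> smooth_model_grad f p gamma x (t x).
  apply: (@smooth_model_grad_cvg R n f p gamma p1 _ (nbhs (x : 'rV[R]_n)) _ id t).
  - exact: cvg_id.
  - exact: ct (mem_set xr).
  - exact: chess.
(* The gradient formula holds throughout the ball, a neighbourhood of [x], so the limit passes to
   the gradient of the envelope. *)
apply: cvg_trans sm; apply: (@near_eq_cvg _ _ (nbhs (x : 'rV[R]_n)) _).
have : \forall z \near x, eball 0 r z by exact: (open_nbhs_nbhs (conj oB xr)).
by apply: filterS => z zr; rewrite (diffE z zr).2.
Qed.

End Theorem28.

Theorem theorem28 (R : realType) (n : nat) (nu p L r : R)
  (f : 'rV[R]_n -> R) (g : 'rV[R]_n -> \bar R) (U : set 'rV[R]_n)
  (hnu : 0 < nu <= 1) (hp : p = 1 + nu)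
  (hL : 0 <= L)
  (hfdiff : forall x, differentiable f x)
  (hfholder : holder_gradient nu L f)
  (hgninfty : avoids_ninfty g)
  (hgproper : proper_fun g)
  (hglsc : lower_semicontinuous g)
  (hgprox : prox_bounded p g)
  (hr : 0 < r)
  (hUopen : open U)
  (hUball : closure (eball 0 r) `<=` U)
  (hfC2 : C2_on U f) :
  (exists gamma_bar : R,
     [/\ 0 < gamma_bar, (gamma_bar%:E < prox_threshold p g)%E &
         forall gamma : R, 0 < gamma < gamma_bar ->
           C1e_on (eball 0 r) (fb_envelope f g p gamma) ->
           single_valued_continuous_on (eball 0 r)
             (fb_splitting f g p gamma)])
  /\
  (forall gamma : R, 0 < gamma -> (gamma%:E < prox_threshold p g)%E ->
     single_valued_continuous_on (eball 0 r) (fb_splitting f g p gamma) ->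
     C1e_on (eball 0 r) (fb_envelope f g p gamma) /\
     forall xb yb : 'rV[R]_n, eball 0 r xb ->
       fb_splitting f g p gamma xb = [set yb] ->
       grad (fun x => fine (fb_envelope f g p gamma x)) xb =
         (yb - xb) *m hess f xb
         + (gamma^-1 * enorm (xb - yb) `^ (p - 2)) *: (xb - yb)).
Proof.
split; first exact: (splitting_of_C1_envelope hnu hp hL hfdiff hfholder
  hgninfty hgproper hglsc hgprox hr hUopen hUball hfC2).
move=> gamma g0 _ hT.
have [C1 gradE] := C1_envelope_of_splitting hnu hp hfdiff hgninfty hgproper
  hUopen hUball hfC2 g0 hT.
split=> // xb yb xr /(gradE _ _ xr) ->.
by rewrite /smooth_model_grad /dmap scalerA.
Qed.
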